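(* For every integer $n\geq 1$ and every complex number $m\in\mathbb{C}\setminus\mathbb{Z}^{-}$ with $m\neq -3/2$, \[ \sum_{k=0}^n 2^{2k} \frac{\binom{m+k}{k}}{\binom{2k}{k}}\left ( H_{k+m}^2 - H_{k+m}^{(2)}\right ) = \frac{A(m,n)}{2m+3} - \frac{B(m,n)}{(2m+3)^2} + 8 \frac{C(m,n)}{(2m+3)^3}, \] where \[ A(m,n) = H_m^2-H_m^{(2)} + 2^{2n+1} \frac{\binom{m+n}{n}}{\binom{2n}{n}} \left ( H_{m+n}+(m+n+1)\left (H_{m+n}^2-H_{m+n}^{(2)}\right )\right ), \] \[ B(m,n) = 2^{2n+2} (m+n+1) \frac{\binom{m+n}{n}}{\binom{2n}{n}}H_{m+n} + 4H_m + 2^{2n+1}(2n-1) \frac{\binom{m+n}{n}}{\binom{2n}{n}} H_{m+n}, \] \[ C(m,n) = 2^{2n} (2n-1) \frac{\binom{m+n}{n}}{\binom{2n}{n}} + 1. \] In particular, \[ \sum_{k=0}^n \frac{2^{2k}}{\binom{2k}{k}}\left ( H_{k}^2 - H_{k}^{(2)}\right ) = \frac{2^{2n+1}}{3 \binom{2n}{n}}\left ((n+1)\left( H_{n}^2 - H_{n}^{(2)}\right ) - \frac{2}{3} (2n-1) H_n \right ) + \frac{8}{27}\left ((2n-1) \frac{2^{2n}}{\binom{2n}{n}} + 1 \right). \]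
   Context: $\mathbb{Z}^{-}$ denotes the set of negative integers. For complex $r,s$ the generalized binomial coefficient is $\binom{r}{s}=\frac{\Gamma(r+1)}{\Gamma(s+1)\Gamma(r-s+1)}$. For $z\in\mathbb{C}\setminus\mathbb{Z}^{-}$ the harmonic number is $H_z=\psi(z+1)+\gamma$ (with $\psi=\Gamma'/\Gamma$ the digamma function and $\gamma$ the Euler–Mascheroni constant), $H_z^2$ denotes $(H_z)^2$, and the second-order harmonic number is $H_z^{(2)}=\zeta(2)-\psi'(z+1)$, so that $H_0^{(2)}=0$, $H_z^{(2)}=H_{z-1}^{(2)}+1/z^2$; for a non-negative integer $n$, $H_n=\sum_{j=1}^n 1/j$ and $H_n^{(2)}=\sum_{j=1}^n 1/j^2$. *)

(* Defs.v *)
From Stdlib Require Import Reals ZArith.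
From Coquelicot Require Import Coquelicot.

Open Scope C_scope.

Definition NtoC (n : nat) : C := RtoC (INR n).
Coercion NtoC : nat >-> C.

Definition negative_integer (z : C) : Prop :=
  exists j : Z, (j < 0)%Z /\ z = RtoC (IZR j).

Definition Cexp (z : C) : C :=
  RtoC (exp (Re z)) * (cos (Im z), sin (Im z)).

Definition C_lim_seq (u : nat -> C) : C :=
  (real (Lim_seq (fun n => Re (u n))), real (Lim_seq (fun n => Im (u n)))).

Fixpoint pochhammer (z : C) (n : nat) : C :=
  match n with
  | O => 1
  | S k => pochhammer z k * (z + k)
  end.

(* Euler's limit Gamma(z) = lim_n n! n^z / (z (z+1) ... (z+n)), which exists for
   every complex z other than 0, -1, -2, ...  Here n^z is exp (z ln n). *)
Definition Gamma (z : C) : C :=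
  C_lim_seq (fun n =>
    NtoC (fact n) * Cexp (z * RtoC (ln (INR n))) / pochhammer z (S n)).

Definition Cbinom (r s : C) : C :=
  Gamma (r + 1) / (Gamma (s + 1) * Gamma (r - s + 1)).

Definition digamma (z : C) : C := C_derive Gamma z / Gamma z.

Definition trigamma (z : C) : C := C_derive digamma z.

Definition euler_gamma : R :=
  real (Lim_seq (fun n => sum_n_m (fun k => / INR k) 1 n - ln (INR n)))%R.

(* The Riemann zeta function at integers s >= 2. *)
Definition zeta (s : nat) : R := Series (fun k => / INR (S k) ^ s)%R.

Definition harmonic (z : C) : C := digamma (z + 1) + RtoC euler_gamma.

Definition harmonic2 (z : C) : C := RtoC (zeta 2) - trigamma (z + 1).

Definition termA (m : C) (n : nat) : C :=
  harmonic m ^ 2 - harmonic2 m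
  + 2 ^ (2 * n + 1) * (Cbinom (m + n) n / Cbinom (2 * n) n)
    * (harmonic (m + n)
       + (m + n + 1) * (harmonic (m + n) ^ 2 - harmonic2 (m + n))).

Definition termB (m : C) (n : nat) : C :=
  2 ^ (2 * n + 2) * (m + n + 1) * (Cbinom (m + n) n / Cbinom (2 * n) n)
    * harmonic (m + n)
  + 4 * harmonic m
  + 2 ^ (2 * n + 1) * (2 * n - 1) * (Cbinom (m + n) n / Cbinom (2 * n) n)
    * harmonic (m + n).

Definition termC (m : C) (n : nat) : C :=
  2 ^ (2 * n) * (2 * n - 1) * (Cbinom (m + n) n / Cbinom (2 * n) n) + 1.

(* Main.v *)
(** On the half-plane [Re z > 0] the logarithm of Euler's product for [Gamma z] is the series
    [- Clog z + sum_k (z ln (1 + 1/(k+1)) + ln (k+1) - Clog (z + k + 1))], whose terms are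
    O(1/k^2); so [Gamma = Cexp o log_Gamma] there.  The series may be differentiated twice
    term by term, because the next derivatives of the terms are dominated by 1/k^2; this
    identifies digamma and trigamma, and their values at 1.  The functional equation of Gamma
    carries existence, non-vanishing and differentiability to every [z] other than
    0, -1, -2, ..., and yields the recurrences of both harmonic functions.  With these, the
    summation formula follows by induction on [n], starting from the trivial case [n = 0]. *)
Require Import Defs.
From Stdlib Require Import Reals ZArith Lra Lia.
From Coquelicot Require Import Coquelicot.

Open Scope C_scope.

(** * Derivatives of complex functions along the real direction *)

(* Derivative along the real direction, componentwise: [C_derive] is defined through Coquelicot's
   [C_lim], which only moves the real part of its argument. *)
Definition is_Dx (f : C -> C) (z l : C) : Prop :=
  is_derive (fun t => Re (f (t, Im z))) (Re z) (Re l) /\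
  is_derive (fun t => Im (f (t, Im z))) (Re z) (Im l).

(** Passes from increments h to a moving point t, the form of difference quotient in which
    [C_derive] is defined. *)
Lemma is_lim_quotient (f : R -> R) (x l : R) :
  is_derive f x l -> is_lim (fun t => (f t - f x) / (t - x))%R x l.
Proof.
  intros H. apply is_derive_Reals in H. apply is_lim_spec. intros eps.
  destruct (H eps (cond_pos eps)) as [d Hd].
  exists d. intros t Ht Hne.
  replace t with (x + (t - x))%R at 1 by ring.
  apply Hd; [lra | exact Ht].
Qed.

Lemma is_Dx_unique (f : C -> C) (z l : C) : is_Dx f z l -> C_derive f z = l.
Proof.
  intros [H1 H2]. destruct z as [x y], l as [a b]. simpl in *.
  apply is_lim_quotient in H1, H2.
  (* On a horizontal line the denominator is the real number t - x, so the complex quotient splits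
     into the two real ones. *)
  assert (E : forall t : R, t <> x ->
    ((f (t, y) - f (x, y)) / ((t, y) - (x, y)))
    = (((Re (f (t, y)) - Re (f (x, y))) / (t - x))%R,
       ((Im (f (t, y)) - Im (f (x, y))) / (t - x))%R)).
  { intros t Ht. destruct (f (t, y)) as [p q], (f (x, y)) as [p' q'].
    unfold Cdiv, Cinv, Cmult, Cminus, Cplus, Copp; simpl.
    f_equal; field; split; [lra | | lra |];
    intros K; assert ((t - x) ^ 2 = 0)%R by nra; nra. }
  unfold C_derive, C_lim. simpl. apply injective_projections; simpl.
  - change a with (real (Finite a)). f_equal. apply is_lim_unique.
    eapply is_lim_ext_loc; [| exact H1].
    exists (mkposreal 1 Rlt_0_1). intros t _ Ht. symmetry. exact (f_equal fst (E t Ht)).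
  - change b with (real (Finite b)). f_equal. apply is_lim_unique.
    eapply is_lim_ext_loc; [| exact H2].
    exists (mkposreal 1 Rlt_0_1). intros t _ Ht. symmetry. exact (f_equal snd (E t Ht)).
Qed.

Lemma is_Dx_ext_loc (f g : C -> C) (z l : C) :
  locally (Re z) (fun t => f (t, Im z) = g (t, Im z)) ->
  is_Dx f z l -> is_Dx g z l.
Proof.
  intros L [H1 H2].
  split; (eapply is_derive_ext_loc; [| eassumption]);
    (eapply filter_imp; [| exact L]); intros t Ht;
    [exact (f_equal Re Ht) | exact (f_equal Im Ht)].
Qed.

Lemma is_Dx_const (c z : C) : is_Dx (fun _ => c) z 0.
Proof. split; simpl; apply @is_derive_const. Qed.

Lemma is_Dx_id (z : C) : is_Dx (fun w => w) z 1.
Proof. split; simpl; [apply @is_derive_id | apply @is_derive_const]. Qed.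

Lemma is_Dx_plus (f g : C -> C) (z a b : C) :
  is_Dx f z a -> is_Dx g z b -> is_Dx (fun w => f w + g w) z (a + b).
Proof. intros [? ?] [? ?]. split; simpl; now apply @is_derive_plus. Qed.

Lemma is_Dx_minus (f g : C -> C) (z a b : C) :
  is_Dx f z a -> is_Dx g z b -> is_Dx (fun w => f w - g w) z (a - b).
Proof. intros [? ?] [? ?]. split; simpl; now apply @is_derive_minus. Qed.

Lemma is_Dx_opp (f : C -> C) (z a : C) : is_Dx f z a -> is_Dx (fun w => - f w) z (- a).
Proof. intros [? ?]. split; simpl; now apply @is_derive_opp. Qed.

Lemma is_derive_eq (f : R -> R) (x l l' : R) : is_derive f x l -> l = l' -> is_derive f x l'.
Proof. now intros H <-. Qed.

Lemma is_Dx_eq (f : C -> C) (z l l' : C) : is_Dx f z l -> l = l' -> is_Dx f z l'.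
Proof. now intros H <-. Qed.

Lemma is_derive_mult_R (f g : R -> R) (x a b : R) :
  is_derive f x a -> is_derive g x b ->
  is_derive (fun t => (f t * g t)%R) x (a * g x + f x * b)%R.
Proof. intros H K. apply (is_derive_mult f g x a b H K Rmult_comm). Qed.

(** Both components of a product are bilinear in the components of the factors, so the real product
    rule suffices. *)
Lemma is_Dx_mult (f g : C -> C) (z a b : C) :
  is_Dx f z a -> is_Dx g z b -> is_Dx (fun w => f w * g w) z (a * g z + f z * b).
Proof.
  intros [A1 A2] [B1 B2]. destruct z as [x y]. unfold Re, Im in *.
  assert (S := fun F G c d => @is_derive_plus R_AbsRing R_NormedModule F G x c d).
  assert (T := fun F G c d => @is_derive_minus R_AbsRing R_NormedModule F G x c d).
  split; simpl in *.
  - eapply is_derive_eq; [apply T; apply is_derive_mult_R; eassumption |].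
    unfold minus, plus, opp; simpl; ring.
  - eapply is_derive_eq; [apply S; apply is_derive_mult_R; eassumption |].
    unfold minus, plus, opp; simpl; ring.
Qed.

Lemma Cmod_sqr_pos (z : C) : z <> 0 -> (0 < Re z ^ 2 + Im z ^ 2)%R.
Proof. intros H. rewrite <- Cmod2_alt. apply pow_lt. now apply Cmod_gt_0. Qed.

Lemma is_Dx_inv (z : C) : z <> 0 -> is_Dx (fun w => / w) z (- / (z * z)).
Proof.
  intros H. apply Cmod_sqr_pos in H. destruct z as [x y]. simpl in H.
  assert (K : (x * (x * 1) + y * (y * 1) <> 0)%R) by lra.
  (* This is |z * z|^2, the denominator that [/ (z * z)] unfolds to; it equals |z|^4. *)
  assert (K' : ((x * x - y * y) * ((x * x - y * y) * 1)
     + (x * y + y * x) * ((x * y + y * x) * 1) <> 0)%R).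
  { replace (_ + _)%R with ((x * (x * 1) + y * (y * 1)) * (x * (x * 1) + y * (y * 1)))%R by ring.
    nra. }
  split; simpl; auto_derive; try exact K;
    (field; split; lra).
Qed.

(** * The complex exponential and the logarithm on the right half-plane *)

Lemma Cexp_plus (a b : C) : Cexp (a + b) = Cexp a * Cexp b.
Proof.
  destruct a as [a1 a2], b as [b1 b2]. unfold Cexp; simpl.
  rewrite exp_plus, cos_plus, sin_plus.
  unfold Cmult, RtoC; simpl; f_equal; ring.
Qed.

Lemma Cexp_0 : Cexp 0 = 1.
Proof. unfold Cexp; simpl. rewrite exp_0, cos_0, sin_0. unfold Cmult, RtoC; simpl; f_equal; ring. Qed.

(** Otherwise 1 = Cexp z * Cexp (- z) would vanish. *)
Lemma Cexp_neq_0 (z : C) : Cexp z <> 0.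
Proof.
  intros H. apply C1_nz. rewrite <- Cexp_0.
  replace (RtoC 0) with (z + - z) by ring.
  rewrite Cexp_plus, H. ring.
Qed.

Lemma Cexp_opp (z : C) : Cexp (- z) = / Cexp z.
Proof.
  assert (H : Cexp z * Cexp (- z) = 1).
  { rewrite <- Cexp_plus, Cplus_opp_r. apply Cexp_0. }
  assert (N := Cexp_neq_0 z).
  replace (Cexp (- z)) with (/ Cexp z * (Cexp z * Cexp (- z))) by (field; exact N).
  rewrite H. ring.
Qed.

Lemma Cexp_RtoC (x : R) : Cexp x = exp x.
Proof.
  unfold Cexp; simpl. rewrite cos_0, sin_0. unfold Cmult, RtoC; simpl; f_equal; ring.
Qed.

(** Since f bends the horizontal line, the horizontal derivative of an outer function gives no chain
    rule by itself. The composite is therefore differentiated directly, through the real exp, cos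
    and sin. *)
Lemma is_Dx_exp (f : C -> C) (z a : C) :
  is_Dx f z a -> is_Dx (fun w => Cexp (f w)) z (Cexp (f z) * a).
Proof.
  intros [A1 A2]. destruct z as [x y]. unfold Re, Im in *. unfold Cexp.
  assert (E1 : is_derive (fun t => exp (fst (f (t, y)))) x (fst a * exp (fst (f (x, y))))%R).
  { apply (is_derive_comp exp (fun t => fst (f (t, y)))); [apply is_derive_exp | exact A1]. }
  assert (E2 : is_derive (fun t => cos (snd (f (t, y)))) x (snd a * - sin (snd (f (x, y))))%R).
  { apply (is_derive_comp cos (fun t => snd (f (t, y)))); [apply is_derive_cos | exact A2]. }
  assert (E3 : is_derive (fun t => sin (snd (f (t, y)))) x (snd a * cos (snd (f (x, y))))%R).
  { apply (is_derive_comp sin (fun t => snd (f (t, y)))); [apply is_derive_sin | exact A2]. }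
  split; simpl in *.
  - eapply is_derive_eq.
    + eapply is_derive_ext; [| apply is_derive_mult_R; [exact E1 | exact E2]].
      intros t; unfold Re, Im; simpl; ring.
    + unfold Re, Im; simpl; ring.
  - eapply is_derive_eq.
    + eapply is_derive_ext; [| apply is_derive_mult_R; [exact E1 | exact E3]].
      intros t; unfold Re, Im; simpl; ring.
    + unfold Re, Im; simpl; ring.
Qed.

(* The principal branch, on the right half-plane only. *)
Definition Clog (z : C) : C := ((ln (Re z ^ 2 + Im z ^ 2) / 2)%R, atan (Im z / Re z)).

Lemma Cexp_log (z : C) : (0 < Re z)%R -> Cexp (Clog z) = z.
Proof.
  destruct z as [x y]; intros H; simpl in H. unfold Cexp, Clog; simpl.
  assert (P : (0 < x * (x * 1) + y * (y * 1))%R) by nra.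
  set (q := (x * (x * 1) + y * (y * 1))%R) in *.
  assert (E : exp (ln q / 2) = sqrt q).
  { rewrite <- Rpower_sqrt by exact P. unfold Rpower. f_equal. field. }
  (* As x > 0, this turns the cosine and sine of the argument into x / |z| and y / |z|, where q =
     |z|^2. *)
  assert (Q : (sqrt (1 + (y / x)²) = sqrt q / x)%R).
  { replace (1 + (y / x)²)%R with (q / x ^ 2)%R by (unfold q, Rsqr; field; lra).
    rewrite sqrt_div_alt by nra. rewrite sqrt_pow2 by lra. reflexivity. }
  assert (S := sqrt_lt_R0 q P).
  rewrite E, cos_atan, sin_atan, Q.
  unfold Cmult, RtoC; simpl; f_equal; field; split; lra.
Qed.

Lemma is_Dx_log (z : C) : (0 < Re z)%R -> is_Dx Clog z (/ z).
Proof.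
  destruct z as [x y]; intros H; simpl in H.
  assert (P : (0 < x * (x * 1) + y * (y * 1))%R) by nra.
  split; simpl; auto_derive; unfold Re, Im; simpl; try lra.
  field. split; nra.
Qed.

(** * Termwise differentiation of series *)

(* The second derivatives being dominated by [M], the difference quotients of [u k] at [x]
   are within [M k * |h|] of [du k x], and these errors sum to O(|h|). *)
Lemma is_derive_Series (u du ddu : nat -> R -> R) (M : nat -> R) (a x : R) :
  (a < x)%R ->
  (forall k t, (a < t)%R -> is_derive (u k) t (du k t)) ->
  (forall k t, (a < t)%R -> is_derive (du k) t (ddu k t)) ->
  (forall k t, (a < t)%R -> Rabs (ddu k t) <= M k)%R ->
  ex_series M ->
  (forall t, (a < t)%R -> ex_series (fun k => u k t)) ->
  ex_series (fun k => du k x) ->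
  is_derive (fun t => Series (fun k => u k t)) x (Series (fun k => du k x)).
Proof.
  intros Hax Du Ddu HM SM Su Sdu.
  assert (MV : forall (f df : R -> R) (p q : R), (a < p)%R -> (a < q)%R ->
    (forall t, (a < t)%R -> is_derive f t (df t)) ->
    exists c, (Rmin p q <= c <= Rmax p q)%R /\ (f q - f p = df c * (q - p))%R).
  { intros f df p q Hp Hq Hf. apply MVT_gen.
    - intros t Ht. apply Hf. revert Ht. unfold Rmin; destruct (Rle_dec p q); lra.
    - intros t Ht. apply derivable_continuous_pt. exists (df t).
      apply is_derive_Reals, Hf. revert Ht. unfold Rmin; destruct (Rle_dec p q); lra. }
  assert (HM0 : forall k, (0 <= M k)%R).
  { intros k. apply Rle_trans with (2 := HM k x Hax). apply Rabs_pos. }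
  assert (S0 : (0 <= Series M)%R).
  { replace 0%R with (Series (fun k => 0 * M k))%R by (rewrite Series_scal_l; ring).
    apply Series_le; [| exact SM]. intros k. specialize (HM0 k). lra. }
  apply is_derive_Reals. intros eps Heps.
  (* The first bound keeps x + h to the right of a, the second makes |h| * (Series M + 1) < eps; the
     added 1 keeps the divisor positive when [Series M] is 0. *)
  assert (P : (0 < Rmin (x - a) (eps / (Series M + 1)))%R).
  { apply Rmin_pos; [lra |]. apply Rdiv_lt_0_compat; lra. }
  exists (mkposreal _ P). intros h Hh Hlt. simpl in Hlt.
  assert (L1 := Rlt_le_trans _ _ _ Hlt (Rmin_l _ _)).
  assert (L2 := Rlt_le_trans _ _ _ Hlt (Rmin_r _ _)).
  assert (Hxh : (a < x + h)%R) by (apply Rabs_def2 in L1; lra).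
  assert (T : forall k,
    (Rabs (/ h * (u k (x + h) - u k x) - du k x) <= Rabs h * M k)%R).
  { intros k.
    destruct (MV (u k) (du k) x (x + h)%R Hax Hxh (Du k)) as [c [Hc Ec]].
    assert (Hac : (a < c)%R).
    { revert Hc. unfold Rmin; destruct (Rle_dec x (x + h)); lra. }
    destruct (MV (du k) (ddu k) x c Hax Hac (Ddu k)) as [c' [Hc' Ec']].
    assert (Hac' : (a < c')%R).
    { revert Hc'. unfold Rmin; destruct (Rle_dec x c); lra. }
    rewrite Ec.
    replace (/ h * (du k c * (x + h - x)) - du k x)%R with (du k c - du k x)%R by (field; lra).
    rewrite Ec', Rabs_mult, Rmult_comm.
    apply Rmult_le_compat; try apply Rabs_pos; [| now apply HM].
    revert Hc. unfold Rmin, Rmax, Rabs.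
    destruct (Rle_dec x (x + h)); destruct (Rcase_abs (c - x)); destruct (Rcase_abs h); lra. }
  assert (E : ((Series (fun k => u k (x + h)) - Series (fun k => u k x)) / h
      - Series (fun k => du k x)
    = Series (fun k => / h * (u k (x + h) - u k x) - du k x))%R).
  { rewrite (Series_minus (fun k => / h * (u k (x + h) - u k x))%R (fun k => du k x)).
    - rewrite Series_scal_l, Series_minus by (apply Su; assumption). field. exact Hh.
    - apply (ex_series_scal_l (/ h)%R (fun k => u k (x + h) - u k x)%R).
      apply (ex_series_minus (fun k => u k (x + h)%R) (fun k => u k x)); now apply Su.
    - exact Sdu. }
  assert (SM' : ex_series (fun k => Rabs h * M k)%R) by exact (ex_series_scal_l (Rabs h) M SM).
  rewrite E. eapply Rle_lt_trans.
  { apply Series_Rabs. eapply (ex_series_le (V := R_CompleteNormedModule)); [| exact SM'].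
    intros k. unfold norm; simpl. unfold abs; simpl. rewrite Rabs_Rabsolu. apply T. }
  eapply Rle_lt_trans.
  { apply Series_le; [| exact SM']. intros k. split; [apply Rabs_pos | apply T]. }
  rewrite Series_scal_l.
  apply Rmult_lt_compat_r with (r := (Series M + 1)%R) in L2; [| lra].
  unfold Rdiv in L2. rewrite Rmult_assoc, Rinv_l in L2 by lra.
  assert (A := Rabs_pos h). nra.
Qed.

Lemma is_lim_seq_inv_INR_S : is_lim_seq (fun n => / INR (S n))%R 0%R.
Proof.
  apply -> (is_lim_seq_incr_1 (fun n => / INR n)%R).
  apply (is_lim_seq_inv INR p_infty is_lim_seq_INR). discriminate.
Qed.

(** Comparison with a telescoping series: for N >= 1, 1/N^2 <= 2/(N (N+1)) = 2 (1/N - 1/(N+1)). *)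
Lemma ex_series_inv_sqr : ex_series (fun k => / INR (S k) ^ 2)%R.
Proof.
  assert (T : ex_series (fun k => / INR (S k) - / INR (S (S k)))%R).
  { exists 1%R. change (is_lim_seq (sum_n (fun k => / INR (S k) - / INR (S (S k)))%R) 1).
    apply is_lim_seq_ext with (fun n => 1 - / INR (S (S n)))%R.
    { intros n. induction n as [| n IH].
      - rewrite sum_O. simpl. field.
      - rewrite sum_Sn, <- IH. unfold plus; simpl Hierarchy.plus; simpl AbelianMonoid.plus.
        change (1 - / INR (S (S (S n))) =
          (1 - / INR (S (S n))) + (/ INR (S (S n)) - / INR (S (S (S n)))))%R. ring. }
    replace (Finite 1) with (Finite (1 - 0)) by (f_equal; ring).
    apply is_lim_seq_minus'; [apply is_lim_seq_const |].
    apply -> (is_lim_seq_incr_1 (fun n => / INR (S n))%R). apply is_lim_seq_inv_INR_S. }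
  eapply (ex_series_le (V := R_CompleteNormedModule));
    [| exact (ex_series_scal_l 2%R _ T)].
  intros k. change (Rabs (/ INR (S k) ^ 2) <= 2 * (/ INR (S k) - / INR (S (S k))))%R.
  assert (P : (1 <= INR (S k))%R) by (apply (le_INR 1); lia).
  rewrite (S_INR (S k)). set (N := INR (S k)) in *.
  rewrite Rabs_pos_eq by (apply Rlt_le, Rinv_0_lt_compat, pow_lt; lra).
  replace (2 * (/ N - / (N + 1)))%R with (2 / (N * (N + 1)))%R by (field; lra).
  apply (Rmult_le_reg_r (N ^ 2 * (N + 1))); [apply Rmult_lt_0_compat; [apply pow_lt |]; lra |].
  replace (/ N ^ 2 * (N ^ 2 * (N + 1)))%R with (N + 1)%R by (field; lra).
  replace (2 / (N * (N + 1)) * (N ^ 2 * (N + 1)))%R with (2 * N)%R by (field; lra).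
  lra.
Qed.

Definition CSeries (a : nat -> C) : C :=
  (Series (fun k => Re (a k)), Series (fun k => Im (a k))).

Definition ex_CSeries (a : nat -> C) : Prop :=
  ex_series (fun k => Re (a k)) /\ ex_series (fun k => Im (a k)).

Lemma im_le_Cmod (z : C) : (Rabs (Im z) <= Cmod z)%R.
Proof. eapply Rle_trans; [apply Rmax_r | apply Rmax_Cmod]. Qed.

Lemma ex_CSeries_le (a : nat -> C) (K : R) :
  (forall k, Cmod (a k) <= K * / INR (S k) ^ 2)%R -> ex_CSeries a.
Proof.
  intros H. assert (S := ex_series_scal_l K _ ex_series_inv_sqr).
  split; (eapply (ex_series_le (V := R_CompleteNormedModule)); [| exact S]);
    intros k; (eapply Rle_trans; [| exact (H k)]); [apply re_le_Cmod | apply im_le_Cmod].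
Qed.

(** A bound on the modulus dominates both components, so the real theorem applies to each of them
    along the horizontal line through z, with a = 0. *)
Lemma is_Dx_CSeries (u du ddu : nat -> C -> C) (K : R) (z : C) :
  (0 < Re z)%R ->
  (forall k w, (0 < Re w)%R -> is_Dx (u k) w (du k w)) ->
  (forall k w, (0 < Re w)%R -> is_Dx (du k) w (ddu k w)) ->
  (forall k w, (0 < Re w)%R -> Cmod (ddu k w) <= K * / INR (S k) ^ 2)%R ->
  (forall w, (0 < Re w)%R -> ex_CSeries (fun k => u k w)) ->
  ex_CSeries (fun k => du k z) ->
  is_Dx (fun w => CSeries (fun k => u k w)) z (CSeries (fun k => du k z)).
Proof.
  intros Hz Du Ddu HM Su [S1 S2]. destruct z as [x y]; simpl in Hz.
  assert (SM := ex_series_scal_l K _ ex_series_inv_sqr).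
  split; simpl.
  - eapply (is_derive_Series (fun k t => Re (u k (t, y))) (fun k t => Re (du k (t, y)))
      (fun k t => Re (ddu k (t, y)))); try eassumption.
    + intros k t Ht. exact (proj1 (Du k (t, y) Ht)).
    + intros k t Ht. exact (proj1 (Ddu k (t, y) Ht)).
    + intros k t Ht. eapply Rle_trans; [apply re_le_Cmod | exact (HM k (t, y) Ht)].
    + intros t Ht. exact (proj1 (Su (t, y) Ht)).
  - eapply (is_derive_Series (fun k t => Im (u k (t, y))) (fun k t => Im (du k (t, y)))
      (fun k t => Im (ddu k (t, y)))); try eassumption.
    + intros k t Ht. exact (proj2 (Du k (t, y) Ht)).
    + intros k t Ht. exact (proj2 (Ddu k (t, y) Ht)).
    + intros k t Ht. eapply Rle_trans; [apply im_le_Cmod | exact (HM k (t, y) Ht)].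
    + intros t Ht. exact (proj2 (Su (t, y) Ht)).
Qed.

(** A real shift slides the horizontal line along itself, so here the chain rule does hold for
    horizontal derivatives. *)
Lemma is_Dx_shift (f : C -> C) (c : R) (z l : C) :
  is_Dx f (z + c) l -> is_Dx (fun w => f (w + c)) z l.
Proof.
  assert (Sh : forall (g : R -> R) (x d : R),
    is_derive g (x + c)%R d -> is_derive (fun t => g (t + c)%R) x d).
  { intros g x d H. eapply is_derive_eq.
    - apply (is_derive_comp g (fun t => t + c)%R x d 1%R H).
      auto_derive; [exact I | ring].
    - apply Rmult_1_l. }
  intros [H1 H2]. split.
  - exact (Sh _ _ _ H1).
  - exact (Sh _ _ _ H2).
Qed.

(** * The logarithmic factors of Euler's product and their derivatives *)

Definition log_step (k : nat) : R := ln (1 + / INR (S k)).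

(** The logarithm of the factor (1 + 1/(k+1))^z (k+1) / (z+k+1). As [log_step k] is ln (k+2) - ln
    (k+1), the powers telescope. *)
Definition log_term (k : nat) (z : C) : C :=
  z * RtoC (log_step k) + RtoC (ln (INR (S k))) - Clog (z + RtoC (INR (S k))).

Definition psi_term (k : nat) (z : C) : C :=
  RtoC (log_step k) - / (z + RtoC (INR (S k))).

Definition trigamma_term (k : nat) (z : C) : C :=
  / ((z + RtoC (INR (S k))) * (z + RtoC (INR (S k)))).

Lemma INR_S_ge_1 (k : nat) : (1 <= INR (S k))%R.
Proof. apply (le_INR 1). lia. Qed.

Lemma Cneq_0_Re (z : C) : (0 < Re z)%R -> z <> 0.
Proof. intros H ->. simpl in H. lra. Qed.

Lemma is_Dx_log_term (k : nat) (z : C) :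
  (0 < Re z)%R -> is_Dx (log_term k) z (psi_term k z).
Proof.
  intros H. assert (N := INR_S_ge_1 k). unfold log_term, psi_term.
  eapply is_Dx_eq.
  - apply is_Dx_minus.
    + apply is_Dx_plus; [apply is_Dx_mult; [apply is_Dx_id | apply is_Dx_const] |
        apply is_Dx_const].
    + apply (is_Dx_shift Clog). apply is_Dx_log. destruct z; simpl in *; lra.
  - cbv beta. ring.
Qed.

Lemma is_Dx_inv_shift (c : R) (z : C) :
  z + c <> 0 -> is_Dx (fun w => / (w + c)) z (- / ((z + c) * (z + c))).
Proof. intros H. apply (is_Dx_shift Cinv). now apply is_Dx_inv. Qed.

Lemma is_Dx_psi_term (k : nat) (z : C) :
  (0 < Re z)%R -> is_Dx (psi_term k) z (trigamma_term k z).
Proof.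
  intros H. assert (N := INR_S_ge_1 k). unfold psi_term, trigamma_term.
  eapply is_Dx_eq.
  - apply is_Dx_minus; [apply is_Dx_const |].
    apply is_Dx_inv_shift, Cneq_0_Re. destruct z; simpl in *; lra.
  - ring.
Qed.

(** Provides the second derivatives of the terms of [psi], whose bound permits differentiating [psi]
    term by term. *)
Lemma is_Dx_trigamma_term (k : nat) (z : C) :
  (0 < Re z)%R ->
  is_Dx (trigamma_term k) z
    (- (2 / ((z + INR (S k)) * (z + INR (S k)) * (z + INR (S k))))).
Proof.
  intros H. assert (N := INR_S_ge_1 k). unfold trigamma_term.
  assert (Z : z + INR (S k) <> 0) by (apply Cneq_0_Re; destruct z; simpl in *; lra).
  apply (is_Dx_shift (fun w => / (w * w)) (INR (S k))).
  set (w := z + INR (S k)) in *.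
  apply is_Dx_ext_loc with (fun w => / w * / w).
  - assert (L : locally (Re w) (fun t : R => (0 < t)%R)).
    { apply (open_gt 0%R). unfold w. destruct z; simpl in *; lra. }
    eapply filter_imp; [| exact L]. intros t Ht. simpl. field.
    apply Cneq_0_Re. exact Ht.
  - eapply is_Dx_eq; [apply is_Dx_mult; apply is_Dx_inv; exact Z |]. field. exact Z.
Qed.

(** The real part alone is already larger. This makes the bounds on the derivatives of the terms
    uniform over the half-plane. *)
Lemma Cmod_shift_ge (k : nat) (z : C) :
  (0 < Re z)%R -> (INR (S k) <= Cmod (z + INR (S k)))%R.
Proof.
  intros H. eapply Rle_trans; [| apply re_le_Cmod].
  eapply Rle_trans; [| apply Rle_abs]. destruct z; simpl in *; lra.
Qed.

Lemma Cmod_trigamma_term (k : nat) (z : C) :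
  (0 < Re z)%R -> (Cmod (trigamma_term k z) <= 1 * / INR (S k) ^ 2)%R.
Proof.
  intros H. assert (N := INR_S_ge_1 k). assert (G := Cmod_shift_ge k z H). unfold trigamma_term.
  assert (Z : z + INR (S k) <> 0) by (apply Cneq_0_Re; destruct z; simpl in *; lra).
  rewrite Cmod_inv, Cmod_mult by now apply Cmult_neq_0.
  rewrite Rmult_1_l. apply Rinv_le_contravar; [apply pow_lt; lra |].
  set (c := Cmod _) in *. set (n := INR (S k)) in *. simpl. nra.
Qed.

Lemma Cmod_trigamma_term_deriv (k : nat) (z : C) :
  (0 < Re z)%R ->
  (Cmod (- (2 / ((z + INR (S k)) * (z + INR (S k)) * (z + INR (S k)))))%C
    <= 2 * / INR (S k) ^ 2)%R.
Proof.
  intros H. assert (N := INR_S_ge_1 k). assert (G := Cmod_shift_ge k z H).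
  assert (Z : z + INR (S k) <> 0) by (apply Cneq_0_Re; destruct z; simpl in *; lra).
  rewrite Cmod_opp, Cmod_div, !Cmod_mult, Cmod_R by (repeat apply Cmult_neq_0; exact Z).
  rewrite Rabs_pos_eq by lra.
  apply Rmult_le_compat_l; [lra |].
  apply Rinv_le_contravar; [apply pow_lt; lra |].
  set (c := Cmod _) in *. set (n := INR (S k)) in *. simpl.
  assert (n * n <= c * c)%R by nra. nra.
Qed.

(** * Quadratic error bounds and convergence of the series *)

Lemma ln_1_plus_bounds (s : R) : (0 <= s)%R -> (s - s ^ 2 <= ln (1 + s) <= s)%R.
Proof.
  assert (U : forall t, (0 < t)%R -> (ln t <= t - 1)%R).
  { intros t Ht. rewrite <- (ln_exp (t - 1)). apply ln_le; [exact Ht |].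
    assert (E := exp_ineq1_le (t - 1)). lra. }
  intros Hs. split.
  (* The lower bound is the inequality ln t <= t - 1 at t = 1/(1+s), combined with (1+s)(1 - s +
     s^2) = 1 + s^3 >= 1. *)
  - assert (I := U (/ (1 + s))%R ltac:(apply Rinv_0_lt_compat; lra)).
    rewrite ln_Rinv in I by lra.
    assert (J : (/ (1 + s) <= 1 - s + s ^ 2)%R).
    { apply (Rmult_le_reg_r (1 + s)); [lra |]. rewrite Rinv_l by lra. nra. }
    lra.
  - assert (I := U (1 + s)%R ltac:(lra)). lra.
Qed.

(** By the mean value theorem the difference is s times -c^2/(1+c^2) for some c between 0 and s, and
    that factor is at most |c| <= |s| in absolute value. *)
Lemma atan_sub_bound (s : R) : (Rabs (atan s - s) <= s ^ 2)%R.
Proof.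
  destruct (MVT_gen (fun t => atan t - t)%R 0 s (fun t => / (1 + t²) - 1)%R) as [c [Hc E]].
  - intros t _. auto_derive; [exact I |]. unfold Rsqr. field. nra.
  - intros t _. apply derivable_continuous_pt. apply derivable_pt_minus.
    + apply derivable_pt_atan.
    + apply derivable_pt_id.
  - rewrite atan_0 in E. replace (atan s - s)%R with (atan s - s - (0 - 0))%R by ring.
    rewrite E, Rminus_0_r, Rabs_mult.
    assert (B : (Rabs (/ (1 + c²) - 1) <= Rabs c)%R).
    { assert (P : (0 < 1 + c²)%R) by (unfold Rsqr; nra).
      replace (/ (1 + c²) - 1)%R with (- (c² / (1 + c²)))%R by (field; lra).
      rewrite Rabs_Ropp, Rabs_pos_eq.
      - apply (Rmult_le_reg_r (1 + c²)); [exact P |].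
        unfold Rdiv. rewrite Rmult_assoc, Rinv_l, Rmult_1_r by lra.
        unfold Rsqr, Rabs. destruct (Rcase_abs c); nra.
      - apply Rmult_le_pos; [unfold Rsqr; nra | apply Rlt_le, Rinv_0_lt_compat, P]. }
    assert (A : (Rabs c <= Rabs s)%R).
    { revert Hc. unfold Rmin, Rmax, Rabs. destruct (Rle_dec 0 s);
        destruct (Rcase_abs c); destruct (Rcase_abs s); lra. }
    rewrite <- (pow2_abs s). assert (Q := Rabs_pos s). simpl. nra.
Qed.

Lemma log_step_bound (k : nat) :
  (Rabs (log_step k - / INR (S k)) <= / INR (S k) ^ 2)%R.
Proof.
  assert (N := INR_S_ge_1 k). unfold log_step. set (n := INR (S k)) in *.
  assert (P : (0 < / n)%R) by (apply Rinv_0_lt_compat; lra).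
  assert (B := ln_1_plus_bounds (/ n) ltac:(lra)).
  rewrite <- pow_inv in *. apply Rabs_le. nra.
Qed.

Lemma ex_CSeries_psi_term (z : C) : (0 < Re z)%R -> ex_CSeries (fun k => psi_term k z).
Proof.
  intros H. apply (ex_CSeries_le _ (1 + Cmod z)). intros k.
  assert (N := INR_S_ge_1 k). assert (G := Cmod_shift_ge k z H).
  assert (B := log_step_bound k).
  assert (Z : z + INR (S k) <> 0) by (apply Cneq_0_Re; destruct z; simpl in *; lra).
  assert (Z' : RtoC (INR (S k)) <> 0) by (apply Cneq_0_Re; simpl in *; lra).
  unfold psi_term. set (n := INR (S k)) in *.
  (* Inserting 1/n leaves ln (1 + 1/n) - 1/n and 1/n - 1/(z+n) = z/(n (z+n)), both of order
     1/n^2. *)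
  replace (RtoC (log_step k) - / (z + n))
    with (RtoC (log_step k - / n)%R + z / (n * (z + n))).
  2: { rewrite RtoC_minus, RtoC_inv by lra. field. split; assumption. }
  eapply Rle_trans; [apply Cmod_triangle |].
  rewrite Cmod_R, Cmod_div, Cmod_mult, Cmod_R by now apply Cmult_neq_0.
  rewrite (Rabs_pos_eq n) by lra. rewrite Rmult_plus_distr_r, Rmult_1_l.
  apply Rplus_le_compat; [exact B |].
  apply Rmult_le_compat_l; [apply Cmod_ge_0 |].
  apply Rinv_le_contravar; [apply pow_lt; lra |]. simpl; nra.
Qed.

(** With n = k + 1 and |z+n|^2 = n^2 (1+s), the real part is x L - ln (1+s)/2. The first-order parts
    of L and of s/2 contribute x/n each and cancel, leaving quadratic errors. *)
Lemma log_term_re_bound (k : nat) (x y : R) : (0 < x)%R ->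
  (Rabs (Re (log_term k (x, y)))
    <= (x + (x ^ 2 + y ^ 2) + (2 * x + (x ^ 2 + y ^ 2)) ^ 2) * / INR (S k) ^ 2)%R.
Proof.
  intros H. assert (N := INR_S_ge_1 k). assert (B := log_step_bound k).
  unfold log_term, Clog. set (n := INR (S k)) in *. set (L := log_step k) in *.
  simpl Re. set (q := (x ^ 2 + y ^ 2)%R). assert (Q : (0 <= q)%R) by (unfold q; nra).
  set (s := ((2 * x * n + q) / n ^ 2)%R).
  assert (I : (0 < / n)%R) by (apply Rinv_0_lt_compat; lra).
  assert (J : (/ n <= 1)%R) by (rewrite <- Rinv_1; apply Rinv_le_contravar; lra).
  assert (Es : (s = 2 * x * / n + q * (/ n * / n))%R) by (unfold s; field; lra).
  assert (S0 : (0 <= s)%R)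
    by (rewrite Es; apply Rplus_le_le_0_compat; repeat apply Rmult_le_pos; lra).
  assert (S1 : (s <= (2 * x + q) * / n)%R) 
    by (rewrite Es; assert (/ n * / n <= / n)%R by nra; nra).
  assert (S2 : (s ^ 2 <= (2 * x + q) ^ 2 * / n ^ 2)%R).
  { rewrite <- pow_inv, <- Rpow_mult_distr. apply pow_incr. lra. }
  assert (LB := ln_1_plus_bounds s S0).
  replace (_ + _)%R with ((L - / n) * x - q / 2 * / n ^ 2 + (s - ln (1 + s)) / 2)%R.
  - rewrite <- pow_inv in *. apply Rabs_le_between in B.
    apply Rabs_le. assert (0 < (/ n) ^ 2)%R by (apply pow_lt; lra).
    set (v := ((/ n) ^ 2)%R) in *. assert (0 <= (2 * x + q) ^ 2)%R by nra.
    set (W := ((2 * x + q) ^ 2)%R) in *. split; nra.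
  - replace ((x + n) * ((x + n) * 1) + (y + 0) * ((y + 0) * 1))%R with (n * n * (1 + s))%R
      by (unfold s, q; field; lra).
    replace (ln (n * n * (1 + s))) with (2 * ln n + ln (1 + s))%R
      by (rewrite !ln_mult by nra; ring).
    unfold s. field. lra.
Qed.

(** With n = k + 1 the imaginary part is y L - atan w. Replacing L by 1/n and atan w by w costs
    quadratic errors, and y/n - w = x y/(n (x+n)) is itself quadratic. *)
Lemma log_term_im_bound (k : nat) (x y : R) : (0 < x)%R ->
  (Rabs (Im (log_term k (x, y))) <= (Rabs y + Rabs y * x + y ^ 2) * / INR (S k) ^ 2)%R.
Proof.
  intros H. assert (N := INR_S_ge_1 k). assert (B := log_step_bound k).
  unfold log_term, Clog. set (n := INR (S k)) in *. set (L := log_step k) in *.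
  simpl Im. set (w := (y / (x + n))%R).
  assert (A := atan_sub_bound w).
  assert (I : (0 < / n)%R) by (apply Rinv_0_lt_compat; lra).
  assert (I' : (0 < / (x + n))%R) by (apply Rinv_0_lt_compat; lra).
  assert (J : (/ (x + n) <= / n)%R) by (apply Rinv_le_contravar; lra).
  replace (_ + _)%R with (y * (L - / n) + y * (x * (/ n * / (x + n))) + - (atan w - w))%R.
  - eapply Rle_trans; [apply Rabs_triang |].
    rewrite !Rmult_plus_distr_r. apply Rplus_le_compat.
    + eapply Rle_trans; [apply Rabs_triang |]. rewrite Rmult_assoc. apply Rplus_le_compat.
      * rewrite Rabs_mult. apply Rmult_le_compat_l; [apply Rabs_pos | exact B].
      * rewrite Rabs_mult. apply Rmult_le_compat_l; [apply Rabs_pos |].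
        rewrite <- pow_inv, Rabs_pos_eq by (apply Rmult_le_pos; nra).
        apply Rmult_le_compat_l; [lra |]. simpl. nra.
    + rewrite Rabs_Ropp. eapply Rle_trans; [exact A |].
      unfold w, Rdiv. rewrite Rpow_mult_distr. apply Rmult_le_compat_l; [nra |].
      rewrite <- pow_inv. apply pow_incr. lra.
  - replace ((y + 0) / (x + n))%R with w by (unfold w; rewrite Rplus_0_r; reflexivity).
    unfold w. field. lra.
Qed.

Lemma ex_CSeries_log_term (z : C) : (0 < Re z)%R -> ex_CSeries (fun k => log_term k z).
Proof.
  destruct z as [x y]; intros H; simpl in H.
  split.
  - eapply (ex_series_le (V := R_CompleteNormedModule));
      [| exact (ex_series_scal_l (x + (x ^ 2 + y ^ 2) + (2 * x + (x ^ 2 + y ^ 2)) ^ 2)%R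
                  _ ex_series_inv_sqr)].
    intros k. exact (log_term_re_bound k x y H).
  - eapply (ex_series_le (V := R_CompleteNormedModule));
      [| exact (ex_series_scal_l (Rabs y + Rabs y * x + y ^ 2)%R _ ex_series_inv_sqr)].
    intros k. exact (log_term_im_bound k x y H).
Qed.

(** * The series for log Gamma and its two derivatives on the half-plane *)

Definition log_Gamma (z : C) : C := - Clog z + CSeries (fun k => log_term k z).

Definition psi (z : C) : C := - / z + CSeries (fun k => psi_term k z).

Lemma is_Dx_log_Gamma (z : C) : (0 < Re z)%R -> is_Dx log_Gamma z (psi z).
Proof.
  intros H. apply is_Dx_plus.
  - apply is_Dx_opp, is_Dx_log, H.
  - apply (is_Dx_CSeries log_term psi_term trigamma_term 1 z H).
    + exact is_Dx_log_term.
    + exact is_Dx_psi_term.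
    + exact Cmod_trigamma_term.
    + exact ex_CSeries_log_term.
    + exact (ex_CSeries_psi_term z H).
Qed.

Lemma is_Dx_psi (z : C) : (0 < Re z)%R ->
  is_Dx psi z (/ (z * z) + CSeries (fun k => trigamma_term k z)).
Proof.
  intros H. apply is_Dx_plus.
  - replace (/ (z * z)) with (- - / (z * z)) by ring.
    apply is_Dx_opp, is_Dx_inv, Cneq_0_Re, H.
  - eapply (is_Dx_CSeries psi_term trigamma_term _ 2 z H).
    + exact is_Dx_psi_term.
    + exact is_Dx_trigamma_term.
    + exact Cmod_trigamma_term_deriv.
    + exact ex_CSeries_psi_term.
    + apply (ex_CSeries_le _ 1). intros k. exact (Cmod_trigamma_term k z H).
Qed.

(** * Limits of complex sequences *)

Definition is_Clim_seq (u : nat -> C) (l : C) : Prop :=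
  is_lim_seq (fun n => Re (u n)) (Re l) /\ is_lim_seq (fun n => Im (u n)) (Im l).

Lemma is_Clim_seq_unique (u : nat -> C) (l : C) : is_Clim_seq u l -> C_lim_seq u = l.
Proof.
  intros [H1 H2]. unfold C_lim_seq.
  rewrite (is_lim_seq_unique _ _ H1), (is_lim_seq_unique _ _ H2).
  destruct l; reflexivity.
Qed.

Lemma is_Clim_seq_ext (u v : nat -> C) (l : C) :
  (forall n, u n = v n) -> is_Clim_seq u l -> is_Clim_seq v l.
Proof.
  intros E [H1 H2]. split; (eapply is_lim_seq_ext; [| eassumption]);
    intros n; simpl; now rewrite E.
Qed.

Lemma is_Clim_seq_incr_1 (u : nat -> C) (l : C) :
  is_Clim_seq (fun n => u (S n)) l -> is_Clim_seq u l.
Proof. intros [H1 H2]. split; now apply is_lim_seq_incr_1. Qed.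

Lemma is_Clim_seq_const (c : C) : is_Clim_seq (fun _ => c) c.
Proof. split; apply is_lim_seq_const. Qed.

Lemma is_Clim_seq_RtoC (u : nat -> R) (l : R) :
  is_lim_seq u l -> is_Clim_seq (fun n => RtoC (u n)) l.
Proof. intros H. split; simpl; [exact H | apply is_lim_seq_const]. Qed.

Lemma is_Clim_seq_plus (u v : nat -> C) (a b : C) :
  is_Clim_seq u a -> is_Clim_seq v b -> is_Clim_seq (fun n => u n + v n) (a + b).
Proof. intros [? ?] [? ?]. split; simpl; now apply is_lim_seq_plus'. Qed.

Lemma is_Clim_seq_mult (u v : nat -> C) (a b : C) :
  is_Clim_seq u a -> is_Clim_seq v b -> is_Clim_seq (fun n => u n * v n) (a * b).
Proof.
  intros [? ?] [? ?]. split; simpl.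
  - apply is_lim_seq_minus'; now apply is_lim_seq_mult'.
  - apply is_lim_seq_plus'; now apply is_lim_seq_mult'.
Qed.

Lemma is_Clim_seq_exp (u : nat -> C) (a : C) :
  is_Clim_seq u a -> is_Clim_seq (fun n => Cexp (u n)) (Cexp a).
Proof.
  intros [H1 H2]. unfold Cexp. apply is_Clim_seq_mult.
  - apply is_Clim_seq_RtoC. apply is_lim_seq_continuous; [| exact H1].
    apply derivable_continuous_pt, derivable_pt_exp.
  - split; simpl; (apply is_lim_seq_continuous; [| exact H2]).
    + apply continuity_cos.
    + apply continuity_sin.
Qed.

Lemma is_Clim_seq_CSeries (a : nat -> C) :
  ex_CSeries a -> is_Clim_seq (sum_n a) (CSeries a).
Proof.
  assert (E : forall n, Re (sum_n a n) = sum_n (fun k => Re (a k)) n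
                     /\ Im (sum_n a n) = sum_n (fun k => Im (a k)) n).
  { intros n. induction n as [| n [I1 I2]].
    - now rewrite !sum_O.
    - rewrite !sum_Sn, <- I1, <- I2. split; reflexivity. }
  intros [H1 H2]. apply Series_correct in H1, H2. split; simpl.
  - eapply is_lim_seq_ext; [intros n; symmetry; apply (proj1 (E n)) | exact H1].
  - eapply is_lim_seq_ext; [intros n; symmetry; apply (proj2 (E n)) | exact H2].
Qed.

(** * Convergence of Euler's limit on the right half-plane *)

Definition Gamma_seq (z : C) (n : nat) : C :=
  NtoC (fact n) * Cexp (z * RtoC (ln (INR n))) / pochhammer z (S n).

Lemma ln_INR_S (k : nat) : ln (INR (S (S k))) = (ln (INR (S k)) + log_step k)%R.
Proof.
  assert (N := INR_S_ge_1 k). unfold log_step.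
  assert (P : (0 < / INR (S k))%R) by (apply Rinv_0_lt_compat; lra).
  rewrite <- ln_mult by lra. f_equal. rewrite (S_INR (S k)). field. lra.
Qed.

Lemma pochhammer_neq_0 (z : C) (n : nat) :
  (forall k, (k < n)%nat -> z + k <> 0) -> pochhammer z n <> 0.
Proof.
  induction n as [| n IH]; intros H; simpl.
  - exact C1_nz.
  - apply Cmult_neq_0; [apply IH; intros k Hk |]; apply H; lia.
Qed.

(** The steps up to index n telescope to ln (n+2), while Euler's quotient at n + 1 contains (n+1)^z;
    the last summand corrects this. Starting at index 1 avoids the logarithm of 0. *)
Lemma Gamma_seq_S_exp (z : C) (n : nat) : (0 < Re z)%R ->
  Gamma_seq z (S n)
    = Cexp (- Clog z + sum_n (fun k => log_term k z) n + - (z * RtoC (log_step n))).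
Proof.
  intros H.
  assert (Z : forall k : nat, z + k <> 0).
  { intros k. apply Cneq_0_Re. assert (K := pos_INR k). destruct z; simpl in *; lra. }
  assert (EL : forall k, Cexp (Clog (z + RtoC (INR k))) = z + k).
  { intros k. apply Cexp_log. assert (K := pos_INR k). destruct z; simpl in *; lra. }
  assert (E0 : Cexp (Clog z) = z) by now apply Cexp_log.
  assert (Z0 : z <> 0) by now apply Cneq_0_Re.
  induction n as [| n IH].
  - rewrite sum_O.
    replace (- Clog z + log_term 0 z + - (z * log_step 0))
      with (- Clog z + - Clog (z + RtoC (INR 1)) + z * RtoC (ln (INR 1)) + RtoC (ln (INR 1))).
    2: { unfold log_term. change (INR 1) with 1%R. rewrite ln_1. ring. }
    rewrite !Cexp_plus, !Cexp_opp, E0, EL, Cexp_RtoC, exp_ln by (simpl; lra).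
    unfold Gamma_seq. simpl pochhammer. simpl fact.
    specialize (Z 1%nat). unfold NtoC in *. simpl INR in *.
    field. now split.
  - rewrite sum_Sn.
    change (plus ?a ?b) with (a + b).
    replace (- Clog z + (sum_n (fun k => log_term k z) n + log_term (S n) z)
        + - (z * log_step (S n)))
      with ((- Clog z + sum_n (fun k => log_term k z) n + - (z * log_step n))
        + z * log_step n + RtoC (ln (INR (S (S n)))) + - Clog (z + RtoC (INR (S (S n)))))
      by (unfold log_term; ring).
    assert (N := INR_S_ge_1 (S n)).
    set (w := - Clog z + sum_n (fun k => log_term k z) n + - (z * log_step n)) in *.
    rewrite !Cexp_plus, <- IH, Cexp_opp, EL, Cexp_RtoC, exp_ln by lra.
    unfold Gamma_seq. rewrite ln_INR_S.
    change (pochhammer z (S (S (S n)))) with (pochhammer z (S (S n)) * (z + S (S n))).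
    rewrite RtoC_plus.
    replace (z * (RtoC (ln (INR (S n))) + log_step n))
      with (z * ln (INR (S n)) + z * log_step n) by ring.
    rewrite Cexp_plus. change (fact (S (S n))) with (S (S n) * fact (S n))%nat.
    unfold NtoC at 1. rewrite mult_INR, RtoC_mult.
    fold (NtoC (fact (S n))). unfold NtoC in *.
    field. split; [apply Z |]. apply pochhammer_neq_0. intros; apply Z.
Qed.

Lemma Gamma_seq_lim_half_plane (z : C) : (0 < Re z)%R ->
  is_Clim_seq (Gamma_seq z) (Cexp (log_Gamma z)).
Proof.
  intros H. apply is_Clim_seq_incr_1.
  eapply is_Clim_seq_ext; [intros n; symmetry; apply Gamma_seq_S_exp, H |].
  apply is_Clim_seq_exp.
  (* The extra summand is the limit of the correction term, as [log_step n] tends to 0. *)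
  replace (log_Gamma z) with (log_Gamma z + - z * RtoC 0) by ring.
  apply is_Clim_seq_plus.
  - apply is_Clim_seq_plus; [apply is_Clim_seq_const |].
    apply is_Clim_seq_CSeries, ex_CSeries_log_term, H.
  - apply is_Clim_seq_ext with (fun n => - z * RtoC (log_step n)); [intros n; ring |].
    apply is_Clim_seq_mult; [apply is_Clim_seq_const |].
    apply is_Clim_seq_RtoC.
    apply is_lim_seq_le_le with (fun _ => 0%R) (fun n => / INR (S n))%R.
    + intros n. assert (N := INR_S_ge_1 n). unfold log_step.
      assert (P : (0 < / INR (S n))%R) by (apply Rinv_0_lt_compat; lra).
      split; [| apply ln_1_plus_bounds; lra].
      rewrite <- ln_1. apply ln_le; lra.
    + apply is_lim_seq_const.
    + apply is_lim_seq_inv_INR_S.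
Qed.

(** * Continuation to the complement of the poles 0, -1, -2, .. *)

Definition regular (z : C) : Prop := forall k : nat, z + k <> 0.

Lemma regular_half_plane (z : C) : (0 < Re z)%R -> regular z.
Proof.
  intros H k. apply Cneq_0_Re. assert (K := pos_INR k). destruct z; simpl in *; lra.
Qed.

Lemma NtoC_S (n : nat) : NtoC (S n) = n + 1.
Proof. unfold NtoC. now rewrite S_INR, RtoC_plus. Qed.

Lemma regular_succ (z : C) : regular z -> regular (z + 1).
Proof. intros H k. replace (z + 1 + k) with (z + S k) by (rewrite NtoC_S; ring). apply H. Qed.

Lemma regular_neq_0 (z : C) : regular z -> z <> 0.
Proof.
  intros H. specialize (H O). replace z with (z + O); [exact H |].
  unfold NtoC; simpl; ring.
Qed.

Lemma regular_pred (z : C) : z <> 0 -> regular (z + 1) -> regular z.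
Proof.
  intros Z0 H [| k].
  - unfold NtoC; simpl. now rewrite Cplus_0_r.
  - replace (z + S k) with (z + 1 + k) by (rewrite NtoC_S; ring). apply H.
Qed.

(** Finitely many unit shifts bring any point into the right half-plane, so the induction runs on a
    natural number exceeding - Re z. Functional equations supply the step back from z + 1 to z. *)
Lemma regular_ind (P : C -> Prop) :
  (forall z, (0 < Re z)%R -> P z) ->
  (forall z, regular z -> P (z + 1) -> P z) ->
  forall z, regular z -> P z.
Proof.
  intros Base Step z.
  destruct (INR_unbounded (- Re z)) as [N HN].
  revert z HN. induction N as [| N IH]; intros z HN Hz.
  - apply Base. simpl in HN. lra.
  - apply Step; [exact Hz |]. apply IH; [| now apply regular_succ].
    rewrite S_INR in HN. destruct z; simpl in *; lra.
Qed.

(** Functional equations hold at regular points only; this openness along the horizontal line is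
    what allows them to be differentiated. *)
Lemma locally_regular (z : C) :
  regular z -> locally (Re z) (fun t => regular (t, Im z)).
Proof.
  revert z. apply regular_ind.
  - intros [x y] Hx. eapply filter_imp; [| apply (open_gt 0%R); exact Hx].
    intros t Ht. now apply regular_half_plane.
  - intros [x y] Hz [d Hd].
    assert (L0 : locally x (fun t : R => ((t, y) : C) <> RtoC 0)).
    (* The horizontal line meets 0 only when y = 0, and then x is away from 0. *)
    { destruct (Req_dec y 0) as [-> | Hy].
      - assert (Hx : (x <> 0)%R).
        { intros ->. now apply (regular_neq_0 _ Hz). }
        eapply filter_imp; [| apply (open_neq 0%R); exact Hx].
        intros t Ht E. apply Ht. now injection E.
      - apply filter_forall. intros t E. apply Hy. now injection E. }
    assert (L1 : locally x (fun t : R => regular (t + 1, y + 0)%R)).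
    { exists d. intros t Ht. apply Hd.
      change (Rabs ((t + 1) - (x + 1)) < d)%R.
      replace (t + 1 - (x + 1))%R with (t - x)%R by ring. exact Ht. }
    eapply filter_imp; [| exact (filter_and _ _ L0 L1)].
    intros t [E0 E1]. exact (regular_pred (t, y) E0 E1).
Qed.

Lemma pochhammer_succ_l (z : C) (n : nat) :
  pochhammer z (S n) = z * pochhammer (z + 1) n.
Proof.
  induction n as [| n IH].
  - simpl. unfold NtoC; simpl. ring.
  - change (pochhammer z (S (S n))) with (pochhammer z (S n) * (z + S n)).
    rewrite IH, NtoC_S. simpl. ring.
Qed.

(** With N = n + 1, all factors cancel from the ratio of the two quotients except (z + 1 + N) / (z
    N), which is written so that its limit 1/z is visible. *)
Lemma Gamma_seq_succ (z : C) (n : nat) : regular z ->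
  Gamma_seq z (S n) = Gamma_seq (z + 1) (S n) * (/ z + (z + 1) / z * RtoC (/ INR (S n))).
Proof.
  intros Hz. assert (N := INR_S_ge_1 n).
  assert (Z0 := regular_neq_0 z Hz).
  assert (ZN : RtoC (INR (S n)) <> 0) by (apply Cneq_0_Re; simpl in *; lra).
  unfold Gamma_seq. rewrite pochhammer_succ_l.
  change (pochhammer (z + 1) (S (S n)))
    with (pochhammer (z + 1) (S n) * (z + 1 + NtoC (S n))).
  assert (P : pochhammer (z + 1) (S n) <> 0).
  { apply pochhammer_neq_0. intros k _. now apply regular_succ. }
  assert (Q := regular_succ z Hz (S n)).
  replace ((z + 1) * ln (INR (S n))) with (z * ln (INR (S n)) + ln (INR (S n))) by ring.
  rewrite Cexp_plus, Cexp_RtoC, exp_ln, RtoC_inv by lra.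
  unfold NtoC in *. set (p := pochhammer _ _) in *. set (c := RtoC (INR (S n))) in *.
  field. repeat split; assumption.
Qed.

Lemma Gamma_seq_lim_pred (z l : C) : regular z ->
  is_Clim_seq (Gamma_seq (z + 1)) l -> is_Clim_seq (Gamma_seq z) (l / z).
Proof.
  intros Hz [L1 L2]. apply is_Clim_seq_incr_1.
  eapply is_Clim_seq_ext; [intros n; symmetry; apply Gamma_seq_succ, Hz |].
  replace (l / z) with (l * (/ z + (z + 1) / z * RtoC 0)).
  2: { field. now apply regular_neq_0. }
  apply (is_Clim_seq_mult (fun n => Gamma_seq (z + 1) (S n))).
  - split.
    + now apply -> (is_lim_seq_incr_1 (fun n => Re (Gamma_seq (z + 1) n))).
    + now apply -> (is_lim_seq_incr_1 (fun n => Im (Gamma_seq (z + 1) n))).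
  - apply is_Clim_seq_plus; [apply is_Clim_seq_const |].
    apply is_Clim_seq_mult; [apply is_Clim_seq_const |].
    apply is_Clim_seq_RtoC, is_lim_seq_inv_INR_S.
Qed.

Lemma Gamma_seq_lim (z : C) : regular z ->
  is_Clim_seq (Gamma_seq z) (Gamma z) /\ Gamma z <> 0.
Proof.
  revert z. apply regular_ind.
  - intros z Hz. assert (L := Gamma_seq_lim_half_plane z Hz).
    replace (Gamma z) with (Cexp (log_Gamma z)).
    + split; [exact L | apply Cexp_neq_0].
    + symmetry. exact (is_Clim_seq_unique _ _ L).
  - intros z Hz [L NZ]. assert (L' := Gamma_seq_lim_pred z _ Hz L).
    replace (Gamma z) with (Gamma (z + 1) / z).
    + split; [exact L' |]. intros E. apply NZ.
      assert (Z0 := regular_neq_0 z Hz).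
      replace (Gamma (z + 1)) with (Gamma (z + 1) / z * z) by (field; exact Z0).
      rewrite E. ring.
    + symmetry. exact (is_Clim_seq_unique _ _ L').
Qed.

Lemma Gamma_neq_0 (z : C) : regular z -> Gamma z <> 0.
Proof. intros H. apply (Gamma_seq_lim z H). Qed.

Lemma Gamma_succ (z : C) : regular z -> Gamma (z + 1) = z * Gamma z.
Proof.
  intros H. destruct (Gamma_seq_lim (z + 1) (regular_succ z H)) as [L _].
  replace (Gamma z) with (Gamma (z + 1) / z).
  - field. now apply regular_neq_0.
  - symmetry. exact (is_Clim_seq_unique _ _ (Gamma_seq_lim_pred z _ H L)).
Qed.

Lemma Gamma_half_plane (z : C) : (0 < Re z)%R -> Gamma z = Cexp (log_Gamma z).
Proof. intros H. exact (is_Clim_seq_unique _ _ (Gamma_seq_lim_half_plane z H)). Qed.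

(** * Derivatives of Gamma and digamma, and their functional equations *)

Lemma is_Dx_ext_half_plane (f g : C -> C) (z l : C) : (0 < Re z)%R ->
  (forall w, (0 < Re w)%R -> f w = g w) -> is_Dx f z l -> is_Dx g z l.
Proof.
  intros H E. apply is_Dx_ext_loc.
  eapply filter_imp; [| apply (open_gt 0%R); exact H].
  intros t Ht. now apply E.
Qed.

Lemma is_Dx_ext_regular (f g : C -> C) (z l : C) : regular z ->
  (forall w, regular w -> f w = g w) -> is_Dx f z l -> is_Dx g z l.
Proof.
  intros H E. apply is_Dx_ext_loc.
  eapply filter_imp; [| apply locally_regular; exact H].
  intros t Ht. now apply E.
Qed.

Lemma is_Dx_Gamma_half_plane (z : C) : (0 < Re z)%R -> is_Dx Gamma z (Gamma z * psi z).
Proof.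
  intros H. rewrite Gamma_half_plane by exact H.
  eapply is_Dx_ext_half_plane; [exact H | |].
  - intros w Hw. symmetry. now apply Gamma_half_plane.
  - now apply is_Dx_exp, is_Dx_log_Gamma.
Qed.

Lemma is_Dx_Gamma (z : C) : regular z -> is_Dx Gamma z (C_derive Gamma z).
Proof.
  (* Existence is enough, since [C_derive] returns the value of any such derivative; and existence
     passes from z + 1 to z. *)
  intros H. cut (exists l, is_Dx Gamma z l).
  { intros [l Hl]. now rewrite (is_Dx_unique _ _ _ Hl). }
  revert z H. apply regular_ind.
  - intros z Hz. eexists. now apply is_Dx_Gamma_half_plane.
  - intros z Hz [l Hl]. eexists.
    apply is_Dx_ext_regular with (fun w => Gamma (w + 1) * / w); [exact Hz | |].
    + intros w Hw. rewrite Gamma_succ by exact Hw. field. now apply regular_neq_0.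
    + apply is_Dx_mult.
      * apply (is_Dx_shift Gamma 1%R). exact Hl.
      * apply is_Dx_inv. now apply regular_neq_0.
Qed.

(** The derivative of Gamma (z + 1) is computed twice, by shifting and from z Gamma z by the product
    rule. *)
Lemma digamma_succ (z : C) : regular z -> digamma (z + 1) = digamma z + / z.
Proof.
  intros H. assert (Z0 := regular_neq_0 z H). assert (G0 := Gamma_neq_0 z H).
  assert (D1 := is_Dx_Gamma (z + 1) (regular_succ z H)).
  apply (is_Dx_shift Gamma 1%R), is_Dx_unique in D1.
  assert (D2 : is_Dx (fun w => Gamma (w + 1)) z (1 * Gamma z + z * C_derive Gamma z)).
  { apply is_Dx_ext_regular with (fun w => w * Gamma w); [exact H | |].
    - intros w Hw. symmetry. now apply Gamma_succ.
    - apply (is_Dx_mult (fun w => w)); [apply is_Dx_id | now apply is_Dx_Gamma]. }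
  apply is_Dx_unique in D2. rewrite D1 in D2.
  unfold digamma. rewrite Gamma_succ, D2 by exact H. field. now split.
Qed.

Lemma digamma_half_plane (z : C) : (0 < Re z)%R -> digamma z = psi z.
Proof.
  intros H. unfold digamma. rewrite (is_Dx_unique _ _ _ (is_Dx_Gamma_half_plane z H)).
  field. now apply Gamma_neq_0, regular_half_plane.
Qed.

Lemma is_Dx_digamma_half_plane (z : C) : (0 < Re z)%R ->
  is_Dx digamma z (/ (z * z) + CSeries (fun k => trigamma_term k z)).
Proof.
  intros H. eapply is_Dx_ext_half_plane; [exact H | | now apply is_Dx_psi].
  intros w Hw. symmetry. now apply digamma_half_plane.
Qed.

Lemma is_Dx_digamma (z : C) : regular z -> is_Dx digamma z (trigamma z).
Proof.
  intros H. cut (exists l, is_Dx digamma z l).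
  { intros [l Hl]. unfold trigamma. now rewrite (is_Dx_unique _ _ _ Hl). }
  revert z H. apply regular_ind.
  - intros z Hz. eexists. now apply is_Dx_digamma_half_plane.
  - intros z Hz [l Hl]. eexists.
    apply is_Dx_ext_regular with (fun w => digamma (w + 1) - / w); [exact Hz | |].
    + intros w Hw. rewrite digamma_succ by exact Hw. ring.
    + apply is_Dx_minus.
      * apply (is_Dx_shift digamma 1%R). exact Hl.
      * apply is_Dx_inv. now apply regular_neq_0.
Qed.

(** Differentiates the functional equation of digamma, again in two ways. *)
Lemma trigamma_succ (z : C) : regular z -> trigamma (z + 1) = trigamma z - / (z * z).
Proof.
  intros H.
  assert (D1 := is_Dx_digamma (z + 1) (regular_succ z H)).
  apply (is_Dx_shift digamma 1%R), is_Dx_unique in D1.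
  assert (D2 : is_Dx (fun w => digamma (w + 1)) z (trigamma z + - / (z * z))).
  { apply is_Dx_ext_regular with (fun w => digamma w + / w); [exact H | |].
    - intros w Hw. symmetry. now apply digamma_succ.
    - apply is_Dx_plus; [now apply is_Dx_digamma |].
      now apply is_Dx_inv, regular_neq_0. }
  apply is_Dx_unique in D2. rewrite D1 in D2. exact D2.
Qed.

(** * Digamma and trigamma at 1 *)

Lemma CSeries_RtoC (a : nat -> R) : CSeries (fun k => RtoC (a k)) = RtoC (Series a).
Proof.
  unfold CSeries, RtoC; simpl. f_equal.
  transitivity (Series (fun k => 0 * a k)%R).
  - apply Series_ext. intros; ring.
  - rewrite Series_scal_l. ring.
Qed.

Lemma CSeries_ext (a b : nat -> C) : (forall k, a k = b k) -> CSeries a = CSeries b.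
Proof.
  intros E. unfold CSeries. f_equal; apply Series_ext; intros k; now rewrite E.
Qed.

Lemma inv_1_plus_INR (k : nat) : / (1 + RtoC (INR (S k))) = RtoC (/ INR (S (S k))).
Proof.
  assert (N := INR_S_ge_1 (S k)). rewrite RtoC_inv by lra.
  rewrite (S_INR (S k)), RtoC_plus. f_equal. ring.
Qed.

Lemma digamma_1 : digamma 1 = - RtoC euler_gamma.
Proof.
  assert (P : (0 < Re 1)%R) by (simpl; lra).
  rewrite digamma_half_plane by exact P. unfold psi.
  assert (E : forall k, psi_term k 1 = RtoC (log_step k - / INR (S (S k)))%R).
  { intros k. unfold psi_term. rewrite inv_1_plus_INR, RtoC_minus. reflexivity. }
  rewrite (CSeries_ext _ _ E), CSeries_RtoC.
  assert (Ex : ex_series (fun k => log_step k - / INR (S (S k)))%R).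
  { eapply ex_series_ext; [| exact (proj1 (ex_CSeries_psi_term 1 P))].
    intros k. exact (f_equal Re (E k)). }
  apply Series_correct in Ex. set (s := Series _) in *.
  (* The logarithms telescope to ln (n+2), and the reciprocals start at 1/2, so the leading 1
     restores the first term of the harmonic sum. *)
  assert (Sum : forall n, @eq R (sum_n (fun k => log_step k - / INR (S (S k)))%R n)
    (1 - (sum_n_m (fun k => / INR k) 1 (S (S n)) - ln (INR (S (S n)))))%R).
  { intros n. induction n as [| n IH].
    - rewrite sum_O, (sum_n_Sm _ 1 1), sum_n_n, ln_INR_S by lia.
      change (INR 1) with 1%R. rewrite ln_1, Rinv_1.
      change (plus ?a ?b) with (a + b)%R. ring.
    - rewrite sum_Sn, IH, (ln_INR_S (S n)), (sum_n_Sm _ 1 (S (S n))) by lia.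
      change (plus ?a ?b) with (a + b)%R. ring. }
  assert (G : euler_gamma = (1 - s)%R).
  { change (1 - s)%R with (real (Finite (1 - s))). unfold euler_gamma. f_equal.
    apply is_lim_seq_unique.
    (* Two index shifts align the sequence defining the constant with these partial sums, which end
       at n + 2. *)
    apply is_lim_seq_incr_1, is_lim_seq_incr_1.
    eapply is_lim_seq_ext with
      (fun n => 1 - sum_n (fun k => log_step k - / INR (S (S k)))%R n)%R.
    - intros n. rewrite Sum. ring.
    - apply (is_lim_seq_minus' (fun _ => 1%R)); [apply is_lim_seq_const | exact Ex]. }
  rewrite G, RtoC_minus. field.
Qed.

(** The term 1/z^2 at z = 1 is the first term of zeta(2), and the series supplies the terms from
    1/2^2 on. *)
Lemma trigamma_1 : trigamma 1 = RtoC (zeta 2).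
Proof.
  assert (P : (0 < Re 1)%R) by (simpl; lra).
  unfold trigamma. rewrite (is_Dx_unique _ _ _ (is_Dx_digamma_half_plane 1 P)).
  assert (E : forall k, trigamma_term k 1 = RtoC (/ INR (S (S k)) ^ 2)%R).
  { intros k. unfold trigamma_term.
    replace (/ ((1 + INR (S k)) * (1 + INR (S k))))
      with (/ (1 + INR (S k)) * / (1 + INR (S k))).
    - rewrite inv_1_plus_INR, <- RtoC_mult, <- pow_inv. f_equal. simpl. ring.
    - field. apply Cneq_0_Re. simpl. assert (N := INR_S_ge_1 k). simpl in N. lra. }
  rewrite (CSeries_ext _ _ E), CSeries_RtoC.
  unfold zeta. rewrite (Series_incr_1 _ ex_series_inv_sqr).
  rewrite RtoC_plus. f_equal. change (INR 1) with 1%R.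
  rewrite pow1, Rinv_1. field.
Qed.

(** * Recurrences and initial values of the harmonic functions *)

Lemma harmonic_succ (z : C) : regular (z + 1) ->
  harmonic (z + 1) = harmonic z + / (z + 1).
Proof. intros H. unfold harmonic. rewrite digamma_succ by exact H. ring. Qed.

Lemma harmonic2_succ (z : C) : regular (z + 1) ->
  harmonic2 (z + 1) = harmonic2 z + / ((z + 1) * (z + 1)).
Proof. intros H. unfold harmonic2. rewrite trigamma_succ by exact H. ring. Qed.

Lemma harmonic_0 : harmonic 0 = 0.
Proof. unfold harmonic. rewrite Cplus_0_l, digamma_1. ring. Qed.

Lemma harmonic2_0 : harmonic2 0 = 0.
Proof. unfold harmonic2. rewrite Cplus_0_l, trigamma_1. ring. Qed.

(** * Binomial coefficients with natural lower argument *)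

Lemma NtoC_0 : NtoC 0 = 0.
Proof. reflexivity. Qed.

Lemma regular_add (z : C) (n : nat) : regular z -> regular (z + n).
Proof.
  intros H k. replace (z + n + k) with (z + (n + k)%nat); [apply H |].
  unfold NtoC. rewrite plus_INR, RtoC_plus. ring.
Qed.

Lemma regular_1 : regular 1.
Proof. apply regular_half_plane. simpl. lra. Qed.

Lemma regular_S (n : nat) : regular (n + 1).
Proof. rewrite Cplus_comm. apply regular_add, regular_1. Qed.

Lemma pochhammer_1 (n : nat) : pochhammer 1 n = fact n.
Proof.
  induction n as [| n IH].
  - reflexivity.
  - change (pochhammer 1 (S n)) with (pochhammer 1 n * (1 + n)).
    rewrite IH, Cplus_comm, <- NtoC_S. unfold NtoC.
    rewrite <- RtoC_mult, <- mult_INR, Nat.mul_comm. reflexivity.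
Qed.

(** Euler's quotient at N = n + 1 is N! N / (N+1)! = 1 - 1/(N+1). *)
Lemma Gamma_1 : Gamma 1 = 1.
Proof.
  apply is_Clim_seq_unique, is_Clim_seq_incr_1.
  apply is_Clim_seq_ext with (fun n => RtoC (1 - / INR (S (S n)))).
  - intros n. assert (N := INR_S_ge_1 n). assert (N' := INR_S_ge_1 (S n)).
    assert (F := INR_fact_neq_0 (S n)).
    rewrite Cmult_1_l, Cexp_RtoC, exp_ln, pochhammer_1 by lra. unfold NtoC.
    change (fact (S (S n))) with (S (S n) * fact (S n))%nat.
    rewrite mult_INR, <- RtoC_mult, <- RtoC_div by (apply Rmult_integral_contrapositive; lra).
    f_equal. rewrite (S_INR (S n)) in *. field. lra.
  - apply is_Clim_seq_RtoC. replace (Finite 1) with (Finite (1 - 0)) by (f_equal; ring).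
    apply is_lim_seq_minus'; [apply is_lim_seq_const |].
    apply -> (is_lim_seq_incr_1 (fun n => / INR (S n))%R). apply is_lim_seq_inv_INR_S.
Qed.

Lemma Cbinom_0 (z : C) : regular (z + 1) -> Cbinom z 0 = 1.
Proof.
  intros H. unfold Cbinom.
  replace (z - 0 + 1) with (z + 1) by ring.
  rewrite Cplus_0_l, Gamma_1. field. now apply Gamma_neq_0.
Qed.

(** The factor Gamma (m + 1) below stays fixed, so the functional equation acts once above and once
    below. *)
Lemma Cbinom_shift_succ (m : C) (n : nat) : regular (m + 1) ->
  Cbinom (m + S n) (S n) = Cbinom (m + n) n * ((m + n + 1) / (n + 1)).
Proof.
  intros H. unfold Cbinom.
  assert (R1 := regular_add _ n H). assert (R2 := regular_S n).
  rewrite NtoC_S.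
  replace (m + (n + 1) + 1) with (m + 1 + n + 1) by ring.
  replace (m + (n + 1) - (n + 1) + 1) with (m + 1) by ring.
  replace (m + n - n + 1) with (m + 1) by ring.
  replace (m + n + 1) with (m + 1 + n) by ring.
  rewrite !Gamma_succ by assumption.
  field. repeat split; try (now apply Gamma_neq_0). now apply regular_neq_0.
Qed.

Lemma Cbinom_central_neq_0 (n : nat) : Cbinom (2 * n) n <> 0.
Proof.
  unfold Cbinom.
  assert (R : regular (2 * n + 1)).
  { replace (2 * n + 1) with (1 + n + n) by ring. apply regular_add, regular_add, regular_1. }
  replace (2 * n - n + 1) with (n + 1) by ring.
  assert (G := Gamma_neq_0 _ R). assert (G' := Gamma_neq_0 _ (regular_S n)).
  unfold Cdiv. apply Cmult_neq_0; [exact G |].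
  intros E. apply C1_nz.
  rewrite <- (Cinv_r (Gamma (n + 1) * Gamma (n + 1))) by now apply Cmult_neq_0.
  rewrite E. ring.
Qed.

Lemma odd_neq_0 (n : nat) : 2 * n + 1 <> 0.
Proof.
  apply Cneq_0_Re. unfold NtoC. assert (N := pos_INR n). simpl. lra.
Qed.

(** The ratio is (2n+2)(2n+1)/(n+1)^2, where 2n + 2 cancels one factor n + 1 up to the 2. *)
Lemma Cbinom_central_succ (n : nat) :
  Cbinom (2 * S n) (S n) = Cbinom (2 * n) n * (2 * (2 * n + 1) / (n + 1)).
Proof.
  unfold Cbinom.
  assert (R : regular (2 * n + 1)).
  { replace (2 * n + 1) with (1 + n + n) by ring. apply regular_add, regular_add, regular_1. }
  assert (R' := regular_succ _ R). assert (Rn := regular_S n).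
  rewrite NtoC_S.
  replace (2 * (n + 1) + 1) with (2 * n + 1 + 1 + 1) by ring.
  replace (2 * (n + 1) - (n + 1) + 1) with (n + 1 + 1) by ring.
  replace (2 * n - n + 1) with (n + 1) by ring.
  rewrite (Gamma_succ (2 * n + 1 + 1)), (Gamma_succ (2 * n + 1)), (Gamma_succ (n + 1))
    by assumption.
  field. split; [now apply regular_neq_0 | now apply Gamma_neq_0].
Qed.

(** * The summation formula by induction *)

Definition summand_weight (m : C) (n : nat) : C :=
  2 ^ (2 * n) * (Cbinom (m + n) n / Cbinom (2 * n) n).

(** Combines 4 from the power, (m+n+1)/(n+1) from the upper binomial and (n+1)/(2(2n+1)) from the
    central one. The weight is thus a hypergeometric term in n. *)
Lemma summand_weight_succ (m : C) (n : nat) : regular (m + 1) ->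
  summand_weight m (S n) = summand_weight m n * (2 * (m + n + 1) / (2 * n + 1)).
Proof.
  intros H. unfold summand_weight.
  rewrite Cbinom_shift_succ, Cbinom_central_succ by exact H.
  assert (B := Cbinom_central_neq_0 n). assert (O := odd_neq_0 n).
  assert (Z := regular_neq_0 _ (regular_S n)).
  replace (2 * S n)%nat with (S (S (2 * n))) by lia. rewrite !Cpow_S.
  field. repeat split; assumption.
Qed.

Lemma summand_weight_0 (m : C) : regular (m + 1) -> summand_weight m 0 = 1.
Proof.
  intros H. unfold summand_weight. rewrite NtoC_0, Cmult_0_r, Cplus_0_r.
  rewrite !Cbinom_0.
  - simpl. field.
  - rewrite Cplus_0_l. apply regular_1.
  - exact H.
Qed.

(** Together with the two lemmas that follow, this isolates the weight as a single atom, so that the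
    induction reduces to a rational identity. *)
Lemma termA_eq (m : C) (n : nat) :
  termA m n = harmonic m ^ 2 - harmonic2 m
    + 2 * summand_weight m n
      * (harmonic (m + n) + (m + n + 1) * (harmonic (m + n) ^ 2 - harmonic2 (m + n))).
Proof. unfold termA, summand_weight. rewrite Cpow_add_r, Cpow_1_r. ring. Qed.

Lemma termB_eq (m : C) (n : nat) :
  termB m n = summand_weight m n * harmonic (m + n) * (4 * (m + n + 1) + 2 * (2 * n - 1))
    + 4 * harmonic m.
Proof. unfold termB, summand_weight. rewrite !Cpow_add_r, Cpow_1_r. simpl. ring. Qed.

Lemma termC_eq (m : C) (n : nat) : termC m n = summand_weight m n * (2 * n - 1) + 1.
Proof. unfold termC, summand_weight. ring. Qed.

(** The recurrences express everything at n + 1 through the weight and the two harmonic values at m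
    + n. With these and the harmonic values at m as atoms, the step is an identity of rational
    functions with denominators m+n+1, 2n+1 and 2m+3. *)
Lemma weighted_harmonic_sum (m : C) (n : nat) : regular (m + 1) -> m <> - (3 / 2) ->
  @eq C
    (sum_n (fun k => summand_weight m k * (harmonic (k + m) ^ 2 - harmonic2 (k + m))) n)
    (termA m n / (2 * m + 3) - termB m n / (2 * m + 3) ^ 2
      + 8 * (termC m n / (2 * m + 3) ^ 3)).
Proof.
  intros H Hm.
  assert (D : 2 * m + 3 <> 0).
  { intros E. apply Hm. replace m with ((2 * m + 3 - 3) / 2) by field.
    rewrite E. field. }
  rewrite termA_eq, termB_eq, termC_eq.
  assert (E : forall k : nat, k + m = m + k) by (intros; apply Cplus_comm).
  induction n as [| n IH].
  - rewrite sum_O, summand_weight_0, E, NtoC_0, !Cplus_0_r by exact H.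
    field. exact D.
  - rewrite sum_Sn, IH, summand_weight_succ, E by exact H.
    change (plus ?a ?b) with (a + b).
    assert (R : regular (m + n + 1)).
    { replace (m + n + 1) with (m + 1 + n) by ring. now apply regular_add. }
    rewrite NtoC_S. replace (m + (n + 1)) with (m + n + 1) by ring.
    rewrite harmonic_succ, harmonic2_succ by exact R.
    assert (Z := regular_neq_0 _ R). assert (O := odd_neq_0 n).
    field. repeat split; assumption.
Qed.

(** A zero of m + 1 + k would make m the negative integer -(k+1). *)
Lemma regular_of_not_negative_integer (m : C) : ~ negative_integer m -> regular (m + 1).
Proof.
  intros H k E. apply H. exists (- Z.of_nat (S k))%Z. split; [lia |].
  rewrite opp_IZR, <- INR_IZR_INZ, S_INR, RtoC_opp, RtoC_plus.
  replace m with (m + 1 + k - (k + 1)) by ring.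
  rewrite E. unfold NtoC. ring.
Qed.

Lemma summand_weight_at_0 (n : nat) : summand_weight 0 n = 2 ^ (2 * n) / Cbinom (2 * n) n.
Proof.
  unfold summand_weight. rewrite Cplus_0_l.
  assert (E : Cbinom n n = 1).
  { unfold Cbinom. replace (n - n + 1) with (RtoC 1) by ring.
    rewrite Gamma_1. field. apply Gamma_neq_0, regular_S. }
  rewrite E. field. apply Cbinom_central_neq_0.
Qed.

Theorem theorem5p1 :
  forall n : nat, (1 <= n)%nat ->
    (forall m : C, ~ negative_integer m -> m <> - (3 / 2) ->
      sum_n (fun k : nat =>
          2 ^ (2 * k) * (Cbinom (m + k) k / Cbinom (2 * k) k)
          * (harmonic (k + m) ^ 2 - harmonic2 (k + m))) n
      = termA m n / (2 * m + 3)
        - termB m n / (2 * m + 3) ^ 2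
        + 8 * (termC m n / (2 * m + 3) ^ 3))
    /\
    sum_n (fun k : nat =>
        2 ^ (2 * k) / Cbinom (2 * k) k
        * (harmonic k ^ 2 - harmonic2 k)) n
    = 2 ^ (2 * n + 1) / (3 * Cbinom (2 * n) n)
        * ((n + 1) * (harmonic n ^ 2 - harmonic2 n)
           - 2 / 3 * (2 * n - 1) * harmonic n)
      + 8 / 27 * ((2 * n - 1) * (2 ^ (2 * n) / Cbinom (2 * n) n) + 1).
Proof.
  intros n _. split.
  - intros m Hm Hm'. apply weighted_harmonic_sum; [| exact Hm'].
    now apply regular_of_not_negative_integer.
  - assert (M : RtoC 0 <> - (3 / 2)).
    { intros E. apply (f_equal Re) in E. simpl in E. lra. }
    assert (R : regular (0 + 1)) by (rewrite Cplus_0_l; apply regular_1).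
    (* The particular formula is the case m = 0: both harmonic values at m vanish, 2m + 3 = 3, and
       the upper binomial coefficient is 1. *)
    assert (W := weighted_harmonic_sum 0 n R M).
    rewrite termA_eq, termB_eq, termC_eq, harmonic_0, harmonic2_0, summand_weight_at_0,
      !Cplus_0_l in W.
    apply (eq_trans (A := C)) with (sum_n (fun k : nat =>
      summand_weight 0 k * (harmonic (k + 0) ^ 2 - harmonic2 (k + 0))) n).
    + apply sum_n_ext. intros k. rewrite summand_weight_at_0, Cplus_0_r. reflexivity.
    + rewrite W, Cpow_add_r, Cpow_1_r. field. apply Cbinom_central_neq_0.
Qed.
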